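(* For all $\mathcal{A},\mathcal{B},\mathcal{C}$ in $\mathcal{M}(Q)$, one has $$\mathrm{ext}(\mathcal{A},\mathcal{B}*\mathcal{C})\le\mathrm{ext}(\mathcal{A},\mathcal{B})+\mathrm{ext}(\mathcal{A},\mathcal{C}).$$ If $\mathrm{hom}(\mathcal{A},\mathcal{B})=0$ or $\mathrm{ext}(\mathcal{B},\mathcal{C})=0$, then equality holds.
   Context: $k$ is an algebraically closed field of characteristic $0$, and $Q$ is a finite quiver without oriented cycles with vertex set $I$. $\mathbf{N}I$ is the set of vectors with nonnegative integer coordinates in the free abelian group on symbols $\sigma_i$ ($i\in I$). The Euler form is $\langle d,e\rangle=\sum_{i\in I}d_ie_i-\sum_{i\to j}d_ie_j$ (second sum over all arrows of $Q$). For $d\in\mathbf{N}I$, $R_d=\bigoplus_{\alpha:i\to j}\mathrm{Hom}_k(k^{d_i},k^{d_j})$ is the affine variety of representations of $Q$ of dimension vector $d$ (points are identified with representations), acted on by $G_d=\prod_{i\in I}\mathrm{GL}_{d_i}(k)$ by base change. For $\mathcal{A}\subset R_d$, $\mathcal{B}\subset R_e$, the set $\mathcal{A}*\mathcal{B}\subset R_{d+e}$ consists of all $X\in R_{d+e}$ for which there is an exact sequence of representations $0\to N\to X\to M\to 0$ with $M\in\mathcal{A}$, $N\in\mathcal{B}$. $\mathcal{M}(Q)$ is the set of all irreducible, closed, $G_d$-stable subvarieties of the varieties $R_d$, $d\in\mathbf{N}I$; it is closed under $*$. For $\mathcal{A}\subset R_d$, $\mathcal{B}\subset R_e$ in $\mathcal{M}(Q)$,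 $\mathrm{hom}(\mathcal{A},\mathcal{B}):=\min\{\dim_k\mathrm{Hom}_{kQ}(A,B): A\in\mathcal{A},\,B\in\mathcal{B}\}$ and $\mathrm{ext}(\mathcal{A},\mathcal{B}):=\mathrm{hom}(\mathcal{A},\mathcal{B})-\langle d,e\rangle$. *)

(* Defs.v *)
From HB Require Import structures.
From mathcomp Require Import all_boot all_order all_algebra.
From mathcomp Require Import classical_sets.
From mathcomp Require Import mpoly.

Set Implicit Arguments.
Unset Strict Implicit.
Unset Printing Implicit Defensive.

Import GRing.Theory.
Local Open Scope ring_scope.
Local Open Scope classical_set_scope.

(* Families of matrices of varying sizes, as a vector space (the library only *)
(* provides the constant families {ffun I -> vT}).                            *)
Record mxfam (k : fieldType) (I : finType) (m n : I -> nat) : Type :=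
  MxFam { mxfam_val : {dffun forall i, 'M[k]_(m i, n i)} }.

Definition mxfam_app (k : fieldType) (I : finType) (m n : I -> nat)
  (f : mxfam k m n) : forall i, 'M[k]_(m i, n i) := fun i => mxfam_val f i.
Coercion mxfam_app : mxfam >-> Funclass.

Section MxFam.
Variables (k : fieldType) (I : finType) (m n : I -> nat).
Implicit Types (f g h : mxfam k m n) (c : k).

HB.instance Definition _ := [isNew for @mxfam_val k I m n].
HB.instance Definition _ := [Choice of mxfam k m n by <:].

Definition mkmxfam (F : forall i, 'M[k]_(m i, n i)) : mxfam k m n :=
  MxFam [ffun i => F i].

Lemma mxfamE F i : mkmxfam F i = F i.
Proof. exact: ffunE. Qed.

Lemma mxfamP f g : (forall i, f i = g i) <-> f = g.
Proof. by split=> [fg | -> //]; apply/val_inj/ffunP. Qed.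

Definition mxfam_zero := mkmxfam (fun=> 0).
Definition mxfam_opp f := mkmxfam (fun i => - f i).
Definition mxfam_add f g := mkmxfam (fun i => f i + g i).
Definition mxfam_scale c f := mkmxfam (fun i => c *: f i).

Fact mxfam_addA : associative mxfam_add.
Proof. by move=> f g h; apply/mxfamP => i; rewrite !mxfamE addrA. Qed.
Fact mxfam_addC : commutative mxfam_add.
Proof. by move=> f g; apply/mxfamP => i; rewrite !mxfamE addrC. Qed.
Fact mxfam_add0 : left_id mxfam_zero mxfam_add.
Proof. by move=> f; apply/mxfamP => i; rewrite !mxfamE add0r. Qed.
Fact mxfam_addN : left_inverse mxfam_zero mxfam_opp mxfam_add.
Proof. by move=> f; apply/mxfamP => i; rewrite !mxfamE addNr. Qed.

HB.instance Definition _ := GRing.isZmodule.Build (mxfam k m n)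
  mxfam_addA mxfam_addC mxfam_add0 mxfam_addN.

Fact mxfam_scaleA a b f :
  mxfam_scale a (mxfam_scale b f) = mxfam_scale (a * b) f.
Proof. by apply/mxfamP => i; rewrite !mxfamE scalerA. Qed.
Fact mxfam_scale1 : left_id 1 mxfam_scale.
Proof. by move=> f; apply/mxfamP => i; rewrite !mxfamE scale1r. Qed.
Fact mxfam_scaleDr : right_distributive mxfam_scale +%R.
Proof. by move=> a f g; apply/mxfamP => i; rewrite !mxfamE scalerDr. Qed.
Fact mxfam_scaleDl f : {morph mxfam_scale^~ f : a b / a + b}.
Proof. by move=> a b; apply/mxfamP => i; rewrite !mxfamE scalerDl. Qed.

HB.instance Definition _ := GRing.Zmodule_isLmodule.Build k (mxfam k m n)
  mxfam_scaleA mxfam_scale1 mxfam_scaleDr mxfam_scaleDl.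

Lemma mxfam_addE f g i : (f + g) i = f i + g i.
Proof. exact: mxfamE. Qed.
Lemma mxfam_scaleE c f i : (c *: f) i = c *: f i.
Proof. exact: mxfamE. Qed.

Fact mxfam_vect_iso :
  Vector.axiom #|{: {i : I & ('I_(m i) * 'I_(n i))%type}}| (mxfam k m n).
Proof.
pose T := {i : I & ('I_(m i) * 'I_(n i))%type}.
pose entry f (s : T) := f (tag s) (tagged s).1 (tagged s).2.
pose to_row f : 'rV[k]_#|{: T}| := \row_s entry f (enum_val s).
pose of_row (r : 'rV[k]_#|{: T}|) := mkmxfam (fun i =>
  \matrix_(p, q)
    r 0 (enum_rank (Tagged (fun i => 'I_(m i) * 'I_(n i))%type (p, q)))).
exists to_row.
  move=> c f g; apply/rowP=> s.
  by rewrite !mxE /entry mxfam_addE mxfam_scaleE !mxE.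
exists of_row => [f | r].
- by apply/mxfamP => i; apply/matrixP => p q; rewrite mxfamE !mxE enum_rankK.
- apply/rowP=> s; rewrite !mxE /entry mxfamE mxE -[in RHS](enum_valK s).
  by case: (enum_val s) => i [].
Qed.

HB.instance Definition _ :=
  Lmodule_hasFinDim.Build k (mxfam k m n) mxfam_vect_iso.

End MxFam.

(* Affine varieties: the Zariski topology of a finite dimensional space,      *)
(* in the coordinates relative to a fixed basis (any other basis defines the  *)
(* same closed sets).                                                         *)
Definition zariski_closed (k : fieldType) (V : vectType k) (Z : set V) : Prop :=
  exists S : set {mpoly k[\dim {:V}]},
    Z = [set x | forall p, S p -> p.@[fun i => coord (vbasis {:V}) i x] = 0].

Definition irreducible_set (k : fieldType) (V : vectType k) (Z : set V) :
    Prop :=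
  Z !=set0 /\
  forall Y1 Y2 : set V, zariski_closed Y1 -> zariski_closed Y2 ->
    Z `<=` Y1 `|` Y2 -> Z `<=` Y1 \/ Z `<=` Y2.

Record quiver := Quiver {
  vertex : finType;
  arrow : finType;
  src : arrow -> vertex;
  tgt : arrow -> vertex }.

Definition adjacent (Q : quiver) : rel (vertex Q) :=
  fun i j => [exists a : arrow Q, (src a == i) && (tgt a == j)].

Definition acyclic (Q : quiver) : Prop :=
  forall s : seq (vertex Q), cycle (@adjacent Q) s -> s = [::].

Definition dimvec (Q : quiver) : Type := vertex Q -> nat.

Definition dim_add (Q : quiver) (d e : dimvec Q) : dimvec Q :=
  fun i => (d i + e i)%N.

Definition euler (Q : quiver) (d e : dimvec Q) : int :=
  \sum_(i : vertex Q) (d i * e i)%:Z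
  - \sum_(a : arrow Q) (d (src a) * e (tgt a))%:Z.

(* Linear maps k^m -> k^n are the matrices in 'M_(m, n), acting on the right  *)
(* of row vectors; M *m N is thus "M, then N".                                *)
Definition rep (k : fieldType) (Q : quiver) (d : dimvec Q) : Type :=
  mxfam k (fun a : arrow Q => d (src a)) (fun a : arrow Q => d (tgt a)).
HB.instance Definition _ (k : fieldType) (Q : quiver) (d : dimvec Q) :=
  Vector.on (rep k d).

Definition vmap (k : fieldType) (Q : quiver) (d e : dimvec Q) : Type :=
  mxfam k (d : vertex Q -> nat) (e : vertex Q -> nat).
HB.instance Definition _ (k : fieldType) (Q : quiver) (d e : dimvec Q) :=
  Vector.on (vmap k d e).

Definition base_change (k : fieldType) (Q : quiver) (d : dimvec Q)
    (g : vmap k d d) (M : rep k d) : rep k d :=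
  mkmxfam (fun a => invmx (g (src a)) *m M a *m g (tgt a)).

Definition G_stable (k : fieldType) (Q : quiver) (d : dimvec Q)
    (A : set (rep k d)) : Prop :=
  forall g : vmap k d d, (forall i, g i \in unitmx) ->
  forall M, A M -> A (base_change g M).

(* The set M(Q), restricted to subvarieties of R_d. *)
Definition MQ (k : fieldType) (Q : quiver) (d : dimvec Q)
    (A : set (rep k d)) : Prop :=
  [/\ zariski_closed A, irreducible_set A & G_stable A].

Section Hom.
Variables (k : fieldType) (Q : quiver) (d e : dimvec Q).
Variables (M : rep k d) (N : rep k e).

Definition hom_defect (f : vmap k d e) :
    mxfam k (fun a : arrow Q => d (src a)) (fun a : arrow Q => e (tgt a)) :=
  mkmxfam (fun a => M a *m f (tgt a) - f (src a) *m N a).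

Fact hom_defect_is_linear : linear hom_defect.
Proof.
move=> c f g; apply/mxfamP => a.
rewrite [RHS]mxfam_addE [in RHS]mxfam_scaleE !mxfamE.
by rewrite mulmxDr mulmxDl -scalemxAr -scalemxAl scalerBr addrACA -opprD.
Qed.

HB.instance Definition _ :=
  GRing.isLinear.Build k _ _ _ hom_defect hom_defect_is_linear.

Definition Hom_rep : {vspace vmap k d e} := lker (linfun hom_defect).

Lemma Hom_repP (f : vmap k d e) :
  reflect (forall a, M a *m f (tgt a) = f (src a) *m N a) (f \in Hom_rep).
Proof.
rewrite memv_ker lfunE; apply: (iffP eqP) => [/mxfamP f0 a | fE].
  by move/eqP: (f0 a); rewrite !mxfamE subr_eq0 => /eqP.
by apply/mxfamP => a; rewrite !mxfamE fE subrr.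
Qed.

End Hom.

Definition short_exact (k : fieldType) (Q : quiver) (d1 d2 d3 : dimvec Q)
    (N : rep k d1) (X : rep k d2) (M : rep k d3) : Prop :=
  exists (f : vmap k d1 d2) (g : vmap k d2 d3),
    [/\ f \in Hom_rep N X, g \in Hom_rep X M &
        forall i,
          [/\ row_free (f i), (f i == kermx (g i))%MS & row_full (g i)]].

(* Points of A are quotients, points of B are subrepresentations. *)
Definition star (k : fieldType) (Q : quiver) (d e : dimvec Q)
    (A : set (rep k d)) (B : set (rep k e)) : set (rep k (dim_add d e)) :=
  [set X | exists M N, [/\ A M, B N & short_exact N X M]].

(* The minimum of S; 0 if S is empty. *)
Definition min_nat (S : set nat) : nat :=
  xget 0%N [set n | S n /\ forall m, S m -> (n <= m)%N].

Definition hom_set (k : fieldType) (Q : quiver) (d e : dimvec Q)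
    (A : set (rep k d)) (B : set (rep k e)) : nat :=
  min_nat [set n | exists M N, [/\ A M, B N & n = \dim (Hom_rep M N)]].

Definition ext_set (k : fieldType) (Q : quiver) (d e : dimvec Q)
    (A : set (rep k d)) (B : set (rep k e)) : int :=
  (hom_set A B)%:Z - euler d e.

(* Main.v *)
Require Import Defs.
From HB Require Import structures.
From mathcomp Require Import all_boot all_order all_algebra.
From mathcomp Require Import boolp classical_sets mpoly.

(** The Euler form is additive in each argument, so the Euler terms cancel and
    everything is a statement about [hom].  Two facts carry the proof.

    Semicontinuity: for representations M(x), N(x) that depend affinely on a
    parameter x, the locus where the dimension of Hom(M(x), N(x)) exceeds a
    bound is closed, since Hom is the kernel of [hom_defect] and a rank bound
    amounts to the vanishing of minors ([zariski_closed_Hom_gt]).  Hence on an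
    irreducible set finitely many conditions of the form dim Hom <= h that are
    separately attained are attained at a common point ([irreducible_meet]).

    Extensions: every extension of M by N receives an isomorphism from a block
    triangular representation with diagonal blocks M, N and some off-diagonal
    block Z ([short_exact_extension]).  The blocks Z that split are those of
    the form [hom_defect M N phi] ([extension_split]), so Ext(M, N) is the
    cokernel of [hom_defect M N], and its dimension is
    dim Hom(M, N) - <d, e>.

    For the inequality, a common L in A minimises both dim Hom(L, M) and
    dim Hom(L, N), for suitable M in B and N in C, and M + N lies in B * C.
    If hom(A, B) = 0, the reverse inequality holds because N embeds in every
    extension of M by N, so that Hom(L, N) embeds in Hom(L, X).
    If ext(B, C) = 0, let L in A and an extension X of M by N with block Z
    realise hom(A, B * C).  Keep L and Z, and move M in B and then N in C:
    semicontinuity provides M and N such that the extension with block Z still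
    satisfies the same bound and, in addition, Ext(M, N) = 0.  This extension
    then splits as M + N, whence
    hom(A, B * C) >= dim Hom(L, M) + dim Hom(L, N) >= hom(A, B) + hom(A, C). *)

Set Implicit Arguments.
Unset Strict Implicit.
Unset Printing Implicit Defensive.

Import GRing.Theory Num.Theory.
Local Open Scope ring_scope.
Local Open Scope classical_set_scope.

(** * Polynomial functions and affine maps *)

Section PolynomialFunctions.
Variables (k : fieldType) (V : vectType k).

Definition polynomial_fun (f : V -> k) : Prop :=
  exists p : {mpoly k[\dim {:V}]},
    forall x, f x = p.@[fun i => coord (vbasis {:V}) i x].

Lemma polynomial_fun_ext f g : f =1 g -> polynomial_fun g -> polynomial_fun f.
Proof. by move=> fg [p gE]; exists p => x; rewrite fg. Qed.

Lemma polynomial_fun_cst c : polynomial_fun (fun=> c).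
Proof. by exists c%:MP => x; rewrite mevalC. Qed.

Lemma polynomial_funD f g :
  polynomial_fun f -> polynomial_fun g -> polynomial_fun (fun x => f x + g x).
Proof. by move=> [p fE] [q gE]; exists (p + q) => x; rewrite mevalD fE gE. Qed.

Lemma polynomial_funM f g :
  polynomial_fun f -> polynomial_fun g -> polynomial_fun (fun x => f x * g x).
Proof. by move=> [p fE] [q gE]; exists (p * q) => x; rewrite mevalM fE gE. Qed.

Lemma polynomial_fun_sum (I : Type) (s : seq I) (P : pred I) (F : I -> V -> k) :
  (forall i, polynomial_fun (F i)) ->
  polynomial_fun (fun x => \sum_(i <- s | P i) F i x).
Proof.
move=> polyF; elim: s => [|i s IHs].
  apply: polynomial_fun_ext (polynomial_fun_cst 0) => x.
  by rewrite big_nil.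
case Pi: (P i); last first.
  by apply: polynomial_fun_ext IHs => x; rewrite big_cons Pi.
apply: polynomial_fun_ext (polynomial_funD (polyF i) IHs) => x.
by rewrite big_cons Pi.
Qed.

Lemma polynomial_fun_prod (I : Type) (s : seq I) (F : I -> V -> k) :
  (forall i, polynomial_fun (F i)) ->
  polynomial_fun (fun x => \prod_(i <- s) F i x).
Proof.
move=> polyF; elim: s => [|i s IHs].
  apply: polynomial_fun_ext (polynomial_fun_cst 1) => x.
  by rewrite big_nil.
apply: polynomial_fun_ext (polynomial_funM (polyF i) IHs) => x.
by rewrite big_cons.
Qed.

Lemma polynomial_fun_det n (F : V -> 'M[k]_n) :
  (forall i j, polynomial_fun (fun x => F x i j)) ->
  polynomial_fun (fun x => \det (F x)).
Proof.
move=> polyF; apply: polynomial_fun_sum => s.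
apply: polynomial_funM; first exact: polynomial_fun_cst.
by apply: polynomial_fun_prod => i; apply: polyF.
Qed.

Lemma polynomial_fun_linear (l : {linear V -> k^o}) : polynomial_fun l.
Proof.
exists (\sum_(i < \dim {:V}) (l (vbasis {:V})`_i)%:MP * 'X_i) => x.
rewrite [in LHS](coord_vbasis (memvf x)) !linear_sum /=.
by apply: eq_bigr => i _; rewrite linearZ /= mevalM mevalC mevalXU mulrC.
Qed.

Lemma zariski_closed_zeros (T : Type) (f : T -> V -> k) :
  (forall t, polynomial_fun (f t)) ->
  zariski_closed [set x | forall t, f t x = 0].
Proof.
move=> polyf.
exists [set p | exists t, forall x,
  f t x = p.@[fun i => coord (vbasis {:V}) i x]].
apply/seteqP; split=> x /= f0.
  by move=> p [t ftE]; rewrite -ftE.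
by move=> t; have [p ftE] := polyf t; rewrite ftE f0 //; exists t.
Qed.

(** Affine dependence on the parameter is what the block construction of
    extensions provides, and it survives composition with linear
    functionals. *)
Definition affine_map (W : vectType k) (g : V -> W) : Prop :=
  linear (fun x => g x - g 0).

Lemma polynomial_fun_affine (W : vectType k) (g : V -> W)
    (l : {linear W -> k^o}) :
  affine_map g -> polynomial_fun (fun x => l (g x)).
Proof.
move=> aff_g; pose g1 x := l (g x - g 0).
have g1_lin : linear (g1 : V -> k^o).
  by move=> c x y; rewrite /g1 aff_g linearP.
pose L : {linear V -> k^o} :=
  HB.pack g1 (GRing.isLinear.Build _ _ _ _ g1 g1_lin).
have LE x : l (g x) = L x + l (g 0) by rewrite /L /= /g1 linearB subrK.
apply: polynomial_fun_ext LE _.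
by apply: polynomial_funD;
  [apply: polynomial_fun_linear | apply: polynomial_fun_cst].
Qed.

End PolynomialFunctions.

(** * Semicontinuity of the rank, and irreducible sets *)

Section Rank.
Variable k : fieldType.

(** Vanishing of minors in coordinate-free form.  Arbitrary families of vectors
    and functionals are allowed in place of subfamilies of two bases: since
    a closed set may be cut out by any set of polynomials, the larger
    supply costs nothing and makes the converse immediate. *)
Lemma dim_limg_ltP (U W : vectType k) (phi : 'Hom(U, W)) (r : nat) :
  (\dim (limg phi) < r)%N <->
  forall (u : 'I_r -> U) (l : 'I_r -> 'Hom(W, k^o)),
    \det (\matrix_(i, j) l j (phi (u i)) : 'M[k]_r) = 0.
Proof.
split=> [rank_lt u l | minors0].
  pose X := [tuple phi (u i) | i < r].
  have XE (i : 'I_r) : X`_i = phi (u i) by rewrite -tnth_nth tnth_mktuple.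
  have notfreeX : ~~ free X.
    apply/negP => freeX; move: rank_lt; rewrite ltnNge => /negP; apply.
    have -> : r = \dim <<X>>%VS by move: freeX => /eqP ->; rewrite size_tuple.
    by apply/dimvS/span_subvP => _ /mapP[i _ ->]; rewrite memv_img ?memvf.
  apply/eqP/det0P.
  have /existsNP[c] : ~ forall c : 'I_r -> k,
      \sum_i c i *: X`_i = 0 -> forall i, c i = 0.
    by move=> /freeP; apply/negP.
  move=> /not_implyP[c0 /existsNP[i ci]].
  exists (\row_i c i).
    by apply/eqP => /rowP/(_ i); rewrite !mxE.
  apply/rowP => j; rewrite !mxE.
  transitivity (l j (\sum_i c i *: X`_i)); last by rewrite c0 linear0.
  by rewrite linear_sum; apply: eq_bigr => s _; rewrite !mxE XE linearZ.
rewrite ltnNge; apply/negP => rank_ge.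
(* The first r vectors of a basis of the image, together with their dual
   functionals, form an identity minor. *)
pose e := vbasis (limg phi); pose t (i : 'I_r) := widen_ord rank_ge i.
have := minors0 (fun i => (phi^-1)%VF e`_(t i))
                (fun j => linfun (coord e (t j) : W -> k^o)).
rewrite (_ : \matrix_(_, _) _ = 1%:M).
  by rewrite det1; apply/eqP/oner_neq0.
apply/matrixP => i j; rewrite !mxE lfunE /= limg_lfunVK; last first.
  apply/vbasis_mem/mem_nth; rewrite size_tuple; exact: ltn_ord (t i).
have -> : (i == j) = (t i == t j) by rewrite -!val_eqE.
exact: (coord_free (t i) (t j) (basis_free (vbasisP _))).
Qed.

Lemma zariski_closed_rank_lt (V U W : vectType k) (phi : V -> 'Hom(U, W))
    (r : nat) :
  (forall u, affine_map (fun x => phi x u)) ->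
  zariski_closed [set x | (\dim (limg (phi x)) < r)%N].
Proof.
move=> aff_phi.
pose minor (t : ('I_r -> U) * ('I_r -> 'Hom(W, k^o))) x :=
  \det (\matrix_(i, j) t.2 j (phi x (t.1 i)) : 'M[k]_r).
have -> : [set x | (\dim (limg (phi x)) < r)%N] =
          [set x | forall t, minor t x = 0].
  apply/seteqP; split=> x /=.
    by move=> /dim_limg_ltP rank_lt [u l]; apply: rank_lt.
  by move=> m0; apply/dim_limg_ltP => u l; apply: (m0 (u, l)).
apply: zariski_closed_zeros => t; apply: polynomial_fun_det => i j.
apply: polynomial_fun_ext (polynomial_fun_affine (t.2 j) (aff_phi (t.1 i))) => x.
by rewrite mxE.
Qed.

(** Nonempty relatively open subsets of an irreducible set meet: otherwise their
    complements would be two closed sets covering it. *)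
Lemma irreducible_meet (V : vectType k) (Z : set V) (P1 P2 : pred V) :
  irreducible_set Z ->
  zariski_closed [set x | ~~ P1 x] -> zariski_closed [set x | ~~ P2 x] ->
  (exists2 x, Z x & P1 x) -> (exists2 x, Z x & P2 x) ->
  exists x, [/\ Z x, P1 x & P2 x].
Proof.
move=> [_ irrZ] cl1 cl2 [x1 Zx1 P1x1] [x2 Zx2 P2x2].
apply: contrapT => no_x; case: (irrZ _ _ cl1 cl2).
- move=> x Zx /=; case P1x: (P1 x); last by left.
  by right; apply/negP => P2x; apply: no_x; exists x.
- by move=> /(_ x1 Zx1) /=; rewrite P1x1.
- by move=> /(_ x2 Zx2) /=; rewrite P2x2.
Qed.

End Rank.

(** * Homomorphism spaces *)

Lemma dim_mxfam (k : fieldType) (I : finType) (m n : I -> nat) :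
  \dim {: mxfam k m n} = (\sum_i m i * n i)%N.
Proof.
rewrite dimvf [LHS]card_tagged sumnE big_map big_enum.
by apply: eq_bigr => i _; rewrite card_prod !card_ord.
Qed.

Section Hom.
Variables (k : fieldType) (Q : quiver).
Implicit Types d e : dimvec Q.

(** By rank-nullity, dim Hom > h is a strict upper bound on the rank of
    [hom_defect], whose values are affine in x. *)
Lemma zariski_closed_Hom_gt (V : vectType k) d e (M : V -> rep k d)
    (N : V -> rep k e) (h : nat) :
  affine_map M -> affine_map N ->
  zariski_closed [set x | ~~ (\dim (Hom_rep (M x) (N x)) <= h)%N].
Proof.
move=> affM affN.
pose phi x := linfun (hom_defect (M x) (N x)).
have dimE x : (\dim (Hom_rep (M x) (N x)) + \dim (limg (phi x)) =
    \dim {: vmap k d e})%N.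
  by rewrite -(limg_ker_dim (phi x) fullv) (capv_idPr (subvf _)).
have aff_phi u : affine_map (fun x => phi x u).
  move=> c x y /=; apply/mxfamP => a.
  have := congr1 (fun f : rep k d => f a *m u (tgt a)) (affM c x y).
  have := congr1 (fun f : rep k e => u (src a) *m f a) (affN c x y).
  rewrite /= !(mxfam_addE, mxfam_scaleE) !lfunE /= !mxfamE => NE ME.
  have subE X Y X' Y' : X *m u (tgt a) - u (src a) *m Y
      - (X' *m u (tgt a) - u (src a) *m Y') =
      (X - X') *m u (tgt a) - u (src a) *m (Y - Y').
    by rewrite mulmxBl mulmxBr !opprD addrACA.
  rewrite !subE {}NE {}ME [in LHS]mulmxDl [in LHS]mulmxDr opprD addrACA.
  by rewrite -scalemxAl -scalemxAr -scalerBr.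
(* If h is at least the dimension of the source, the truncated difference
   is 0 and both sides are empty. *)
have -> : [set x | ~~ (\dim (Hom_rep (M x) (N x)) <= h)%N] =
    [set x | (\dim (limg (phi x)) < \dim {: vmap k d e} - h)%N].
  by apply/seteqP; split=> x /=; rewrite -ltnNge -(dimE x) ltn_subRL ltn_add2r.
exact: zariski_closed_rank_lt.
Qed.

Definition postcomp d e1 e2 (f : vmap k e1 e2) (g : vmap k d e1) :
    vmap k d e2 :=
  mkmxfam (fun i => g i *m f i).

Fact postcomp_is_linear d e1 e2 (f : vmap k e1 e2) :
  linear (@postcomp d e1 e2 f).
Proof.
move=> c g h; apply/mxfamP => i.
by rewrite mxfam_addE mxfam_scaleE !mxfamE mulmxDl scalemxAl.
Qed.

HB.instance Definition _ d e1 e2 (f : vmap k e1 e2) :=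
  GRing.isLinear.Build k _ _ _ (@postcomp d e1 e2 f) (postcomp_is_linear f).

Lemma postcomp_Hom d e1 e2 (L : rep k d) (N : rep k e1) (X : rep k e2) f g :
  f \in Hom_rep N X -> g \in Hom_rep L N -> postcomp f g \in Hom_rep L X.
Proof.
move=> /Hom_repP f_hom /Hom_repP g_hom; apply/Hom_repP => a.
by rewrite !mxfamE mulmxA g_hom -!mulmxA f_hom.
Qed.

Lemma dim_postcomp_Hom d e1 e2 (f : vmap k e1 e2) (U : {vspace vmap k d e1}) :
  (forall i, row_free (f i)) -> \dim (linfun (postcomp f) @: U) = \dim U.
Proof.
move=> f_inj; apply: limg_dim_eq; apply/eqP; rewrite -subv0.
apply/subvP => g; rewrite memv_cap memv_ker lfunE /= => /andP[_ /eqP fg0].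
rewrite memv0; apply/eqP/mxfamP => i; apply: (row_free_inj (f_inj i)).
have /mxfamP/(_ i) := fg0.
by rewrite !mxfamE mul0mx.
Qed.

Lemma leq_dim_Hom_inj d e1 e2 (L : rep k d) (N : rep k e1) (X : rep k e2)
    (f : vmap k e1 e2) :
  f \in Hom_rep N X -> (forall i, row_free (f i)) ->
  (\dim (Hom_rep L N) <= \dim (Hom_rep L X))%N.
Proof.
move=> f_hom f_inj; rewrite -(dim_postcomp_Hom _ f_inj); apply: dimvS.
apply/subvP => _ /memv_imgP[g g_hom ->].
by rewrite lfunE /=; apply: postcomp_Hom g_hom.
Qed.

(** * Block triangular extensions *)

Section Extension.
Variables d e : dimvec Q.

Definition cocycle : Type :=
  mxfam k (fun a : arrow Q => d (src a)) (fun a : arrow Q => e (tgt a)).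
HB.instance Definition _ := Vector.on cocycle.

Implicit Types (M : rep k d) (N : rep k e) (Z : cocycle).

(** With row vectors, (m, n) is sent to (m M, m Z + n N): the last coordinates
    span a subrepresentation N, with quotient M. *)
Definition extension M N Z : rep k (dim_add d e) :=
  mkmxfam (fun a => block_mx (M a) (Z a) 0 (N a)).

Definition inl_map : vmap k d (dim_add d e) := mkmxfam (fun i => row_mx 1%:M 0).
Definition inr_map : vmap k e (dim_add d e) := mkmxfam (fun i => row_mx 0 1%:M).
Definition fst_map : vmap k (dim_add d e) d := mkmxfam (fun i => col_mx 1%:M 0).
Definition snd_map : vmap k (dim_add d e) e := mkmxfam (fun i => col_mx 0 1%:M).

Lemma inr_map_Hom M N Z : inr_map \in Hom_rep N (extension M N Z).
Proof.
apply/Hom_repP => a; rewrite !mxfamE mul_mx_row mul_row_block.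
by rewrite !mulmx0 !mul0mx mulmx1 mul1mx !add0r.
Qed.

Lemma fst_map_Hom M N Z : fst_map \in Hom_rep (extension M N Z) M.
Proof.
apply/Hom_repP => a; rewrite !mxfamE mul_block_col mul_col_mx.
by rewrite !mulmx0 !mul0mx mulmx1 mul1mx !addr0.
Qed.

Lemma inl_map_Hom M N : inl_map \in Hom_rep M (extension M N 0).
Proof.
apply/Hom_repP => a; rewrite !mxfamE mul_mx_row mul_row_block.
by rewrite !mulmx0 !mul0mx mulmx1 mul1mx !addr0.
Qed.

Lemma snd_map_Hom M N : snd_map \in Hom_rep (extension M N 0) N.
Proof.
apply/Hom_repP => a; rewrite !mxfamE mul_block_col mul_col_mx.
by rewrite !mulmx0 !mul0mx mulmx1 mul1mx !add0r.
Qed.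

Lemma row_free_inl_map i : row_free (inl_map i).
Proof.
apply/row_freeP; exists (fst_map i).
by rewrite !mxfamE mul_row_col mulmx1 mul0mx addr0.
Qed.

Lemma row_free_inr_map i : row_free (inr_map i).
Proof.
apply/row_freeP; exists (snd_map i).
by rewrite !mxfamE mul_row_col mulmx1 mul0mx add0r.
Qed.

Lemma extension_short_exact M N Z : short_exact N (extension M N Z) M.
Proof.
exists inr_map, fst_map; split; [exact: inr_map_Hom | exact: fst_map_Hom |].
move=> i; split; first exact: row_free_inr_map.
  apply/andP; split.
    by apply/sub_kermxP; rewrite !mxfamE mul_row_col mulmx0 mul0mx addr0.
  apply/row_subP => p.
  have : (row p (kermx (fst_map i)) <= kermx (fst_map i))%MS.
    exact: row_sub.
  move: (row p _) => v /sub_kermxP; rewrite !mxfamE -[v]hsubmxK mul_row_col.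
  rewrite mulmx0 addr0 mulmx1 => ->.
  by apply/submxP; exists (rsubmx v); rewrite mul_mx_row mulmx0 mulmx1.
apply/row_fullP; exists (inl_map i).
by rewrite !mxfamE mul_row_col mulmx1 mul0mx addr0.
Qed.

Lemma dim_Hom_direct_sum d0 (L : rep k d0) M N :
  \dim (Hom_rep L (extension M N 0)) =
  (\dim (Hom_rep L M) + \dim (Hom_rep L N))%N.
Proof.
pose U1 := (linfun (postcomp inl_map) @: Hom_rep L M)%VS.
pose U2 := (linfun (postcomp inr_map) @: Hom_rep L N)%VS.
have U12 : (U1 :&: U2)%VS = 0%VS.
  apply/eqP; rewrite -subv0; apply/subvP => h; rewrite memv_cap => /andP[].
  move=> /memv_imgP[f _ ->] /memv_imgP[g _]; rewrite !lfunE /= => /mxfamP fg.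
  rewrite memv0; apply/eqP/mxfamP => i; move: (fg i); rewrite !mxfamE.
  by rewrite !mul_mx_row !mulmx0 mulmx1 => /eq_row_mx[-> _]; rewrite row_mx0.
rewrite -(dim_postcomp_Hom (Hom_rep L M) row_free_inl_map).
rewrite -(dim_postcomp_Hom (Hom_rep L N) row_free_inr_map).
rewrite -dimv_disjoint_sum //; congr (\dim _); apply/eqP; rewrite eqEsubv.
apply/andP; split.
  apply/subvP => h h_hom.
  have -> : h = linfun (postcomp inl_map) (postcomp fst_map h) +
                linfun (postcomp inr_map) (postcomp snd_map h).
    rewrite !lfunE /=; apply/mxfamP => i; rewrite mxfam_addE !mxfamE.
    rewrite -[h i]hsubmxK !mul_row_col !mulmx0 !mulmx1 !(addr0, add0r).
    by rewrite !mul_mx_row !mulmx1 !mulmx0 add_row_mx addr0 add0r.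
  apply: memv_add; apply: memv_img.
    exact: postcomp_Hom (fst_map_Hom _ _ _) h_hom.
  exact: postcomp_Hom (snd_map_Hom _ _) h_hom.
apply/subvP => _
  /memv_addP[_ /memv_imgP[f f_hom ->] [_ /memv_imgP[g g_hom ->] ->]].
rewrite !lfunE /=; apply: rpredD.
  exact: postcomp_Hom (inl_map_Hom _ _) f_hom.
exact: postcomp_Hom (inr_map_Hom _ _ _) g_hom.
Qed.

(** Choosing linear sections s of the quotient maps identifies X, as a family of
    vector spaces, with M + N; the off-diagonal block measures the failure of s
    to be a morphism.  Injectivity of the resulting map is the form in which
    the isomorphism is used to compare homomorphism spaces. *)
Lemma short_exact_extension M N (X : rep k (dim_add d e)) :
  short_exact N X M ->
  exists Z (h : vmap k (dim_add d e) (dim_add d e)),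
    h \in Hom_rep (extension M N Z) X /\ forall i, row_free (h i).
Proof.
move=> [f [g [/Hom_repP f_hom /Hom_repP g_hom exact_fg]]].
have f_free i : row_free (f i) by have [] := exact_fg i.
have kerE i : (f i == kermx (g i))%MS by have [] := exact_fg i.
have [s sK] : exists s : vmap k d (dim_add d e), forall i, s i *m g i = 1%:M.
  exists (mkmxfam (fun i => pinvmx (g i))) => i.
  by have [_ _ g_full] := exact_fg i; rewrite mxfamE mulVpmx.
have fg0 i : f i *m g i = 0 by apply/sub_kermxP; have /andP[] := kerE i.
pose D a := s (src a) *m X a - M a *m s (tgt a).
have D_sub a : (D a <= f (tgt a))%MS.
  have /andP[_] := kerE (tgt a); apply: submx_trans; apply/sub_kermxP.
  by rewrite mulmxBl -!mulmxA g_hom sK mulmxA sK mulmx1 mul1mx subrr.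
pose Z : cocycle := mkmxfam (fun a => D a *m pinvmx (f (tgt a))).
pose h : vmap k (dim_add d e) (dim_add d e) :=
  mkmxfam (fun i => col_mx (s i) (f i)).
exists Z, h; split=> [|i].
  apply/Hom_repP => a; rewrite !mxfamE mul_block_col mul_col_mx mulmxKpV //.
  by rewrite mul0mx add0r f_hom addrC subrK.
rewrite -kermx_eq0 -submx0; apply/row_subP => p.
have : (row p (kermx (h i)) <= kermx (h i))%MS by apply: row_sub.
move: (row p _) => v /sub_kermxP; rewrite mxfamE -[v]hsubmxK mul_row_col => v0.
have l0 : lsubmx v = 0.
  have /(congr1 (mulmxr (g i))) /= := v0.
  by rewrite mulmxDl -!mulmxA sK fg0 mulmx1 mulmx0 addr0 mul0mx.
move: v0; rewrite l0 mul0mx add0r => /eqP.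
by rewrite mulmx_free_eq0 // => /eqP->; rewrite row_mx0 sub0mx.
Qed.

(** The unipotent change of coordinates with off-diagonal part phi alters the
    block Z by a coboundary [hom_defect M N phi]. *)
Lemma extension_split M N (phi : vmap k d e) :
  exists h, h \in Hom_rep (extension M N 0) (extension M N (hom_defect M N phi))
    /\ forall i, row_free (h i).
Proof.
pose h : vmap k (dim_add d e) (dim_add d e) :=
  mkmxfam (fun i => block_mx 1%:M (phi i) 0 1%:M).
exists h; split=> [|i].
  apply/Hom_repP => a; rewrite !mxfamE !mulmx_block.
  by rewrite !(mulmx0, mul0mx, mulmx1, mul1mx, addr0, add0r) subrK.
apply/row_freeP; exists (block_mx 1%:M (- phi i) 0 1%:M).
rewrite mxfamE mulmx_block !(mulmx0, mul0mx, mulmx1, mul1mx, addr0, add0r).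
by rewrite addNr -scalar_mx_block.
Qed.

(** The Euler form is the difference of the dimensions of the source and the
    target of [hom_defect M N], so the hypothesis says that its cokernel, which
    is Ext(M, N), vanishes. *)
Lemma hom_defect_surj M N (Z : cocycle) :
  (\dim (Hom_rep M N))%:Z = euler d e -> exists phi, hom_defect M N phi = Z.
Proof.
move=> dimE.
have rankE := limg_ker_dim (linfun (hom_defect M N)) fullv.
rewrite (capv_idPr (subvf _)) dim_mxfam in rankE.
have full : limg (linfun (hom_defect M N)) = fullv.
  apply/eqP; rewrite eqEdim subvf dim_mxfam.
  move: dimE; rewrite /euler -!(big_morph Posz PoszD (erefl 0%:Z)) -rankE.
  move=> /eqP; rewrite PoszD -addrA -[X in X == _]addr0 (inj_eq (addrI _)).
  by rewrite eq_sym subr_eq0 => /eqP[->] /=.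
have : Z \in limg (linfun (hom_defect M N)) by rewrite full memvf.
by move=> /memv_imgP[phi _ ->]; exists phi; rewrite lfunE.
Qed.

Lemma affine_extension (V : vectType k) (M : V -> rep k d) (N : V -> rep k e)
    (Z : cocycle) :
  affine_map M -> affine_map N -> affine_map (fun x => extension (M x) (N x) Z).
Proof.
move=> affM affN c x y; apply/mxfamP => a.
have := congr1 (fun f : rep k d => f a) (affM c x y).
have := congr1 (fun f : rep k e => f a) (affN c x y).
rewrite /= !(mxfam_addE, mxfam_scaleE) !mxfamE => NE ME.
rewrite !opp_block_mx !add_block_mx NE ME !subrr.
by rewrite [in RHS]scale_block_mx [in RHS]add_block_mx !scaler0 !addr0.
Qed.

End Extension.
End Hom.

(** * Minimal dimensions of homomorphism spaces *)

Lemma affine_map_id (k : fieldType) (V : vectType k) : affine_map (@id V).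
Proof. by move=> c x y; rewrite !subr0. Qed.

Lemma affine_map_cst (k : fieldType) (V W : vectType k) (w : W) :
  affine_map (fun _ : V => w).
Proof. by move=> c x y; rewrite subrr scaler0 addr0. Qed.

Lemma euler_addr (Q : quiver) (a b c : dimvec Q) :
  euler a (dim_add b c) = euler a b + euler a c.
Proof.
rewrite /euler addrACA -opprD -!big_split /=; congr (_ - _).
  by apply: eq_bigr => i _; rewrite mulnDr PoszD.
by apply: eq_bigr => i _; rewrite mulnDr PoszD.
Qed.

Lemma min_natP (S : set nat) :
  S !=set0 -> S (min_nat S) /\ forall m, S m -> (min_nat S <= m)%N.
Proof.
move=> [n0 Sn0].
apply: (@xgetPex _ 0%N [set n | S n /\ forall m, S m -> (n <= m)%N]).
have exS : exists n, `[< S n >] by exists n0; apply/asboolP.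
case: (ex_minnP exS) => n /asboolP Sn n_min.
by exists n; split=> // m /asboolP/n_min.
Qed.

Section HomSet.
Variables (k : fieldType) (Q : quiver).
Implicit Types a b c : dimvec Q.

Lemma hom_setP a b (A : set (rep k a)) (B : set (rep k b)) :
  A !=set0 -> B !=set0 ->
  (exists M N, [/\ A M, B N & \dim (Hom_rep M N) = hom_set A B])
  /\ (forall M N, A M -> B N -> (hom_set A B <= \dim (Hom_rep M N))%N).
Proof.
move=> [M0 AM0] [N0 BN0].
have [|[M [N [AM BN homE]]] hom_le] := @min_natP
  [set n | exists M N, [/\ A M, B N & n = \dim (Hom_rep M N)]].
  by exists (\dim (Hom_rep M0 N0)), M0, N0.
split; first by exists M, N.
by move=> M1 N1 AM1 BN1; apply: hom_le; exists M1, N1.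
Qed.

Lemma star_nonempty b c (B : set (rep k b)) (C : set (rep k c)) :
  B !=set0 -> C !=set0 -> star B C !=set0.
Proof.
move=> [M BM] [N CN]; exists (extension M N 0), M, N; split=> //.
exact: extension_short_exact.
Qed.

(** Only L has to be generic: [hom_set A B] and [hom_set A C] are attained at
    some M and N, and these can be kept while L moves in A. *)
Lemma hom_star_le a b c (A : set (rep k a)) (B : set (rep k b))
    (C : set (rep k c)) :
  irreducible_set A -> B !=set0 -> C !=set0 ->
  (hom_set A (star B C) <= hom_set A B + hom_set A C)%N.
Proof.
move=> irrA B0 C0; have A0 := irrA.1.
have [[L1 [M [AL1 BM homB]]] _] := hom_setP A0 B0.
have [[L2 [N [AL2 CN homC]]] _] := hom_setP A0 C0.
have [||||L [AL LM LN]] := irreducible_meet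
  (P1 := fun L => (\dim (Hom_rep L M) <= hom_set A B)%N)
  (P2 := fun L => (\dim (Hom_rep L N) <= hom_set A C)%N) irrA.
- exact: zariski_closed_Hom_gt (@affine_map_id _ _) (affine_map_cst _).
- exact: zariski_closed_Hom_gt (@affine_map_id _ _) (affine_map_cst _).
- by exists L1; rewrite ?homB.
- by exists L2; rewrite ?homC.
apply: (@leq_trans (\dim (Hom_rep L (extension M N 0)))); last first.
  by rewrite dim_Hom_direct_sum leq_add.
apply: (hom_setP A0 (star_nonempty B0 C0)).2 => //.
by exists M, N; split=> //; apply: extension_short_exact.
Qed.

(** A point N of C is a subrepresentation of X, so Hom(L, N) embeds in
    Hom(L, X). *)
Lemma hom_star_ge_sub a b c (A : set (rep k a)) (B : set (rep k b))
    (C : set (rep k c)) :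
  A !=set0 -> B !=set0 -> C !=set0 ->
  (hom_set A C <= hom_set A (star B C))%N.
Proof.
move=> A0 B0 C0.
have [[L [X [AL [M [N [BM CN [f [g [f_hom _ exact_fg]]]]]] <-]]] _] :=
  hom_setP A0 (star_nonempty B0 C0).
apply: leq_trans (leq_dim_Hom_inj L f_hom _); last by move=> i; case: (exact_fg i).
exact: (hom_setP A0 C0).2.
Qed.

(** The pair (M, N) is made generic one component at a time, which avoids the
    irreducibility of the product of B and C. *)
Lemma hom_star_ge a b c (A : set (rep k a)) (B : set (rep k b))
    (C : set (rep k c)) :
  A !=set0 -> irreducible_set B -> irreducible_set C -> ext_set B C = 0 ->
  (hom_set A B + hom_set A C <= hom_set A (star B C))%N.
Proof.
move=> A0 irrB irrC /eqP; rewrite subr_eq0 => /eqP extBC.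
have B0 := irrB.1; have C0 := irrC.1.
have [[L [X [AL [M0 [N0 [BM0 CN0 X_ext]]] homX]]] _] :=
  hom_setP A0 (star_nonempty B0 C0).
have [[M1 [N1 [BM1 CN1 homBC]]] _] := hom_setP B0 C0.
have [Z [h [h_hom h_inj]]] := short_exact_extension X_ext.
have homZ := leq_dim_Hom_inj L h_hom h_inj; rewrite homX in homZ.
(* M0 realises the first bound with N0, and M1 the second one with N1; a common
   M then keeps both bounds alive for the choice of N. *)
have [||||M [BM MZ MN1]] := irreducible_meet
  (P1 := fun M => (\dim (Hom_rep L (extension M N0 Z)) <=
                   hom_set A (star B C))%N)
  (P2 := fun M => (\dim (Hom_rep M N1) <= hom_set B C)%N) irrB.
- apply: zariski_closed_Hom_gt; first exact: affine_map_cst.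
  exact: affine_extension (@affine_map_id _ _) (affine_map_cst _).
- exact: zariski_closed_Hom_gt (@affine_map_id _ _) (affine_map_cst _).
- by exists M0.
- by exists M1; rewrite ?homBC.
have [||||N [CN NZ MN]] := irreducible_meet
  (P1 := fun N => (\dim (Hom_rep L (extension M N Z)) <=
                   hom_set A (star B C))%N)
  (P2 := fun N => (\dim (Hom_rep M N) <= hom_set B C)%N) irrC.
- apply: zariski_closed_Hom_gt; first exact: affine_map_cst.
  exact: affine_extension (affine_map_cst _) (@affine_map_id _ _).
- exact: zariski_closed_Hom_gt (affine_map_cst _) (@affine_map_id _ _).
- by exists N0.
- by exists N1.
have MN_eq : \dim (Hom_rep M N) = hom_set B C.
  by apply/eqP; rewrite eqn_leq MN (hom_setP B0 C0).2.
have [phi phiE] : exists phi, hom_defect M N phi = Z.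
  by apply: hom_defect_surj; rewrite MN_eq.
have [h' [h'_hom h'_inj]] := extension_split M N phi.
apply: leq_trans NZ; rewrite -phiE.
apply: leq_trans (leq_dim_Hom_inj L h'_hom h'_inj).
by rewrite dim_Hom_direct_sum leq_add // (hom_setP A0 _).2.
Qed.

End HomSet.

Theorem proposition2p8 (k : closedFieldType) (char0 : [pchar k] =i pred0)
    (Q : quiver) (acyclicQ : acyclic Q) (a b c : dimvec Q)
    (A : set (rep k a)) (B : set (rep k b)) (C : set (rep k c))
    (hA : MQ A) (hB : MQ B) (hC : MQ C) :
  ext_set A (star B C) <= ext_set A B + ext_set A C
  /\ (hom_set A B = 0%N \/ ext_set B C = 0 ->
      ext_set A (star B C) = ext_set A B + ext_set A C).
Proof.
have [_ irrA _] := hA; have [_ irrB _] := hB; have [_ irrC _] := hC.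
have [A0 B0 C0] := And3 irrA.1 irrB.1 irrC.1.
have hom_le := hom_star_le irrA B0 C0.
rewrite /ext_set euler_addr opprD.
rewrite [leRHS]addrACA [X in _ -> _ = X]addrACA -PoszD.
split; first by rewrite lerD2r lez_nat.
move=> hom_ge; congr (_%:Z + _); apply/eqP; rewrite eqn_leq hom_le /=.
case: hom_ge => [homAB|extBC]; last exact: hom_star_ge.
by rewrite homAB add0n hom_star_ge_sub.
Qed.
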